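(* Let $V$ be a multiplicative partial isometry (MPI) on a finite dimensional Hilbert space $\mathcal H$, with right leg $A$ and left leg $\hat A$. Then $A$ and $\hat A$ are ${}^*$-subalgebras of $\mathcal L(\mathcal H)$ (i.e. are closed under the adjoint operation) if and only if $V$ is unital and regular.
   Context: $\mathcal H$ is a finite dimensional complex Hilbert space, $\mathcal L(\mathcal H)$ the algebra of linear operators on $\mathcal H$, $\mathcal L(\mathcal H)_*$ the space of linear functionals on $\mathcal L(\mathcal H)$. Leg notation: $V_{ij}$ acts as $V$ on the $i$-th and $j$-th tensor factors of $\mathcal H\otimes\mathcal H\otimes\mathcal H$ and as the identity on the remaining one. A multiplicative partial isometry (MPI) on $\mathcal H$ is an operator $V\in\mathcal L(\mathcal H\otimes\mathcal H)$ with $VV^*V=V$ and $$V_{23}V_{12}=V_{12}V_{13}V_{23},\quad V_{13}V_{23}V_{23}^*=V_{12}^*V_{12}V_{13},\quad V_{12}V_{12}^*V_{23}=V_{23}V_{12}V_{12}^*,\quad V_{12}V_{23}^*V_{23}=V_{23}^*V_{23}V_{12}.$$ Put $\lambda(\omega)=(\omega\otimes\mathrm{id})(V)$ and $\rho(\omega)=(\mathrm{id}\otimes\omega)(V)$ for $\omega\in\mathcal L(\mathcal H)_*$. The right leg of $V$ is $A=\lambda(\mathcal L(\mathcal H)_* )$, the left leg is $\hat A=\rho(\mathcal L(\mathcal H)_* )$; both are subalgebras of $\mathcal L(\mathcal H)$ (not assumed to contain $\mathrm{id}_{\mathcal H}$). $V$ is unital if there exist $\varepsilon,\hat\varepsilon\in\mathcal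 L(\mathcal H)_*$ such that $\mathbf 1:=\lambda(\hat\varepsilon)\in A$ and $\hat{\mathbf 1}:=\rho(\varepsilon)\in\hat A$ are two-sided units for the algebras $A$ and $\hat A$, respectively. Write $V=\sum_k V_1^{k}\otimes V_2^{k}$ and let $\mathcal C(V)=\{\sum_k V_2^{k}XV_1^{k}\mid X\in\mathcal L(\mathcal H)\}$ (equivalently $\mathcal C(V)=\{(\mathrm{id}\otimes\omega)(\Sigma V)\mid\omega\in\mathcal L(\mathcal H)_*\}$ with $\Sigma$ the flip on $\mathcal H\otimes\mathcal H$). Let $A^R=\{(\omega\otimes\mathrm{id})(V^*V)\mid\omega\in\mathcal L(\mathcal H)_*\}$ and let $(A^R)'$ be its commutant in $\mathcal L(\mathcal H)$. A unital MPI $V$ is called regular if $\mathcal C(V)=(A^R)'\cap\mathbf 1\mathcal L(\mathcal H)\mathbf 1$, where $\mathbf 1$ is the unit of $A$. *)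

(* Defs.v *)
From HB Require Import structures.
From mathcomp Require Export all_boot all_order all_algebra.
From mathcomp Require Export mxtens complex reals.

Set Implicit Arguments.
Unset Strict Implicit.
Unset Printing Implicit Defensive.

Import Order.TTheory GRing.Theory Num.Theory.

Local Open Scope ring_scope.
Local Open Scope sesquilinear_scope.

(* A finite dimensional Hilbert space H is identified with C^n by means of an
   orthonormal basis: L(H) is 'M[C]_n (operators act on column vectors, the
   composition is *m, the adjoint is the conjugate transpose ^t* ), L(H (x) H)
   is 'M[C]_(n * n) and L(H (x) H (x) H) is 'M[C]_(n * n * n).  Basis vectors
   of tensor powers are numbered with mxtens_index, so that the tensor product
   of operators is tensmx, written A *t B. *)

Section LegNumbering.
Variables (C : numClosedFieldType) (n : nat).

Definition idx2 (i j : 'I_n) : 'I_(n * n) := mxtens_index (i, j).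

Definition pos1 (k : 'I_(n * n * n)) : 'I_n :=
  (mxtens_unindex (mxtens_unindex k).1).1.
Definition pos2 (k : 'I_(n * n * n)) : 'I_n :=
  (mxtens_unindex (mxtens_unindex k).1).2.
Definition pos3 (k : 'I_(n * n * n)) : 'I_n := (mxtens_unindex k).2.

Definition leg12 (V : 'M[C]_(n * n)) : 'M[C]_(n * n * n) :=
  \matrix_(k, l) (V (idx2 (pos1 k) (pos2 k)) (idx2 (pos1 l) (pos2 l))
                    *+ (pos3 k == pos3 l)).
Definition leg13 (V : 'M[C]_(n * n)) : 'M[C]_(n * n * n) :=
  \matrix_(k, l) (V (idx2 (pos1 k) (pos3 k)) (idx2 (pos1 l) (pos3 l))
                    *+ (pos2 k == pos2 l)).
Definition leg23 (V : 'M[C]_(n * n)) : 'M[C]_(n * n * n) :=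
  \matrix_(k, l) (V (idx2 (pos2 k) (pos3 k)) (idx2 (pos2 l) (pos3 l))
                    *+ (pos1 k == pos1 l)).

(* If V = \sum_k A_k *t B_k, then blockl V i j = \sum_k (B_k i j) *: A_k and
   blockr V i j = \sum_k (A_k i j) *: B_k. *)
Definition blockl (V : 'M[C]_(n * n)) (i j : 'I_n) : 'M[C]_n :=
  \matrix_(k, l) V (idx2 k i) (idx2 l j).
Definition blockr (V : 'M[C]_(n * n)) (i j : 'I_n) : 'M[C]_n :=
  \matrix_(k, l) V (idx2 i k) (idx2 j l).

End LegNumbering.

Section Slices.
Variables (C : numClosedFieldType) (n : nat).
Implicit Types (V : 'M[C]_(n * n)) (w : {scalar 'M[C]_n}).

(* (w (x) id)(V) *)
Definition slicel V w : 'M[C]_n := \matrix_(i, j) w (blockl V i j).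

(* (id (x) w)(V) *)
Definition slicer V w : 'M[C]_n := \matrix_(i, j) w (blockr V i j).

(* \sum_k B_k *m X *m A_k, where V = \sum_k A_k *t B_k; it is computed from the
   decomposition of V along the matrix units, and sandwich_tens says that any
   other decomposition gives the same result. *)
Definition sandwich V (X : 'M[C]_n) : 'M[C]_n :=
  \sum_i \sum_j blockr V i j *m X *m delta_mx i j.

Definition right_leg V (a : 'M[C]_n) : Prop :=
  exists w : {scalar 'M[C]_n}, a = slicel V w.

Definition left_leg V (a : 'M[C]_n) : Prop :=
  exists w : {scalar 'M[C]_n}, a = slicer V w.

Definition calC V (Y : 'M[C]_n) : Prop :=
  exists X : 'M[C]_n, Y = sandwich V X.

Definition commutant (S : 'M[C]_n -> Prop) (Y : 'M[C]_n) : Prop :=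
  forall a, S a -> Y *m a = a *m Y.

Definition is_unit_for (S : 'M[C]_n -> Prop) (e : 'M[C]_n) : Prop :=
  S e /\ forall a, S a -> e *m a = a /\ a *m e = a.

Definition is_subalgebra (S : 'M[C]_n -> Prop) : Prop :=
  [/\ S 0,
      forall (c : C) a b, S a -> S b -> S (c *: a + b) &
      forall a b, S a -> S b -> S (a *m b)].

Definition unital V : Prop :=
  exists eps hateps : {scalar 'M[C]_n},
    is_unit_for (right_leg V) (slicel V hateps) /\
    is_unit_for (left_leg V) (slicer V eps).

End Slices.

Section MPI.
Variables (C : numClosedFieldType) (n : nat).
Implicit Types V : 'M[C]_(n * n).

Definition is_star_subalgebra (S : 'M[C]_n -> Prop) : Prop :=
  is_subalgebra S /\ forall a, S a -> S (a ^t*).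

Definition MPI V : Prop :=
  [/\ V *m V ^t* *m V = V,
      leg23 V *m leg12 V = leg12 V *m leg13 V *m leg23 V,
      leg13 V *m leg23 V *m (leg23 V) ^t* =
        (leg12 V) ^t* *m leg12 V *m leg13 V,
      leg12 V *m (leg12 V) ^t* *m leg23 V =
        leg23 V *m leg12 V *m (leg12 V) ^t* &
      leg12 V *m (leg23 V) ^t* *m leg23 V =
        (leg23 V) ^t* *m leg23 V *m leg12 V].

(* A^R *)
Definition source_right_leg V : 'M[C]_n -> Prop := right_leg (V ^t* *m V).

Definition regular V : Prop :=
  exists2 one : 'M[C]_n, is_unit_for (right_leg V) one &
    forall Y : 'M[C]_n, calC V Y <->
      commutant (source_right_leg V) Y /\
      exists X : 'M[C]_n, Y = one *m X *m one.

End MPI.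

Section Conventions.
Variables (C : numClosedFieldType) (n : nat).
Implicit Types (A B X : 'M[C]_n) (V : 'M[C]_(n * n)).

Lemma idx2E (i j : 'I_n) : mxtens_unindex (idx2 i j) = (i, j).
Proof. exact: mxtens_indexK. Qed.

Lemma leg12_tens A B : leg12 (A *t B) = A *t B *t 1%:M.
Proof. by apply/matrixP=> k l; rewrite !mxE !idx2E mulr_natr. Qed.

Lemma leg13_tens A B : leg13 (A *t B) = A *t 1%:M *t B.
Proof.
by apply/matrixP=> k l; rewrite !mxE !idx2E /= mulr_natr -!mulrnAl.
Qed.

Lemma leg23_tens A B : leg23 (A *t B) = 1%:M *t A *t B.
Proof.
by apply/matrixP=> k l; rewrite !mxE !idx2E /= mulrnAl mul1r -mulrnAl.
Qed.

Lemma slicel_tens A B (w : {scalar 'M[C]_n}) : slicel (A *t B) w = w A *: B.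
Proof.
apply/matrixP=> i j; rewrite !mxE mulrC -linearZ; congr (w _).
by apply/matrixP=> k l; rewrite !mxE !idx2E mulrC.
Qed.

Lemma slicer_tens A B (w : {scalar 'M[C]_n}) : slicer (A *t B) w = w B *: A.
Proof.
apply/matrixP=> i j; rewrite !mxE mulrC -linearZ; congr (w _).
by apply/matrixP=> k l; rewrite !mxE !idx2E.
Qed.

Lemma sandwich_tens m (A B : 'I_m -> 'M[C]_n) X :
  sandwich (\sum_k A k *t B k) X = \sum_k B k *m X *m A k.
Proof.
have blockE i j : blockr (\sum_k A k *t B k) i j = \sum_k A k i j *: B k.
  apply/matrixP=> p q; rewrite mxE !summxE; apply: eq_bigr => k _.
  by rewrite !mxE !idx2E.
rewrite /sandwich; under eq_bigr => i _ do under eq_bigr => j _ do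
  rewrite blockE !mulmx_suml.
under eq_bigr => i _ do rewrite exchange_big /=.
rewrite exchange_big; apply: eq_bigr => k _ /=.
rewrite [in RHS](matrix_sum_delta (A k)) mulmx_sumr; apply: eq_bigr => i _.
rewrite mulmx_sumr; apply: eq_bigr => j _.
by rewrite -!scalemxAl -scalemxAr.
Qed.

End Conventions.

(* Main.v *)
From HB Require Import structures.
Require Import Defs.

Set Implicit Arguments.
Unset Strict Implicit.
Unset Printing Implicit Defensive.

Import Order.TTheory GRing.Theory Num.Theory.

Local Open Scope ring_scope.
Local Open Scope sesquilinear_scope.

(** Write V = sum_k A_k (x) B_k, P = V^* V, Q = V V^*, let e and f be the units
of the right leg A and of the left leg Â, and let S be the sandwich map
X |-> sum_k B_k X A_k, whose image is C(V).

The axioms of a multiplicative partial isometry yield the five identities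
V13 V23 = V12^* V23 V12,  V12 V13 = V23 V12 V23^*,
V12 V23^* = V23^* V12 V13,  V12^* V23 = V13 V23 V12^*,
V23 P12 = P13 V23 (the lemmas prefixed by mpi).  The first two show that the legs are closed
under multiplication, the last that C(V) commutes with A^R.

Unital and regular implies adjoint-closed.  Since C(V) is contained in
e L(H) e, V (e (x) 1) = V.  Slicing P12 V13 = V13 Q23 with the functionals
giving e and f relates the units to the legs of P and Q, which are stable under
adjoints because P and Q are self-adjoint; this forces e = f = e^*
(unit_eq_of_sandwich).  Then C(V) = (A^R)' /\ e L(H) e is closed under adjoints.
Apply tr (b X a Y) c to the legs of V12 V23^* = V23^* V12 V13.  The left side
becomes a general element of A^*, the right side becomes
sum_(j, l) tr (A_j^* S(X) A_l Y) B_j^* B_l.  Taking the adjoint of the latter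
replaces S(X) by S(X)^* and Y by Y^*; since S(X)^* is again in C(V), the result
is again of the form of the left side, so A^* is closed under adjoints
(right_leg_adj).  The left leg is handled with V12^* V23 = V13 V23 V12^*
(left_leg_adj).

Adjoint-closed implies unital and regular.  A finite dimensional *-subalgebra of
matrices has a self-adjoint unit (star_algebra_unit), and the same slicing
argument gives e = f.  The inclusion of C(V) in (A^R)' /\ e L(H) e is direct.
For the converse, A = A^* provides a linear map F with (F (x) id) V^* = V, the
inverse of the antipode of the left leg.  It reverses products on Â and fixes e.
For c in (A^R)' with c e = c put X = sum_k B_k c F(A_k).  Replacing V by
(F (x) id) V^* in the outer copy and using that F reverses products,
S(X) = sum_k P2_k c F(P1_k) = c (sum_k P2_k F(P1_k)), where
P = sum_k P1_k (x) P2_k, since the right leg A^R of P commutes with c.  The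
antipode identity sum_k P2_k F(P1_k) = e (source_antipode1) concludes. *)

(** * Adjoints and positivity *)

Section Adjoint.
Variable C : numClosedFieldType.

Lemma adjM m n p (A : 'M[C]_(m, n)) (B : 'M[C]_(n, p)) :
  (A *m B)^t* = B^t* *m A^t*.
Proof. by rewrite trmx_mul map_mxM. Qed.

Lemma adj_sum (I : finType) m n (F : I -> 'M[C]_(m, n)) :
  (\sum_i F i)^t* = \sum_i (F i)^t*.
Proof. by rewrite !raddf_sum. Qed.

Lemma adjZ m n c (A : 'M[C]_(m, n)) : (c *: A)^t* = c^* *: A^t*.
Proof. by rewrite linearZ /= map_mxZ. Qed.

Lemma adj_tens m n p q (A : 'M[C]_(m, n)) (B : 'M[C]_(p, q)) :
  (A *t B)^t* = A^t* *t B^t*.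
Proof. by rewrite trmx_tens map_mxT. Qed.

Lemma adj1 n : (1%:M : 'M[C]_n)^t* = 1%:M.
Proof. by rewrite trmx1 map_mx1. Qed.

Lemma mxtrace_adj n (a : 'M[C]_n) : \tr (a^t*) = (\tr a)^*.
Proof. by rewrite /mxtrace rmorph_sum; apply: eq_bigr => i _; rewrite !mxE. Qed.

Lemma sum_mul_adj_eq0 n (I : finType) (X : I -> 'M[C]_n) :
  \sum_i X i *m (X i)^t* = 0 -> forall i, X i = 0.
Proof.
move=> X0 i; apply/matrixP=> p j; rewrite mxE.
have ge0 k l : 0 <= X k p l * ((X k)^t*) l p by rewrite !mxE mul_conjC_ge0.
have /matrixP/(_ p p)/eqP := X0; rewrite summxE mxE.
under eq_bigr => k _ do rewrite mxE.
rewrite psumr_eq0 => [/allP/(_ i)|k _]; last exact: sumr_ge0.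
rewrite mem_index_enum => /(_ isT).
rewrite psumr_eq0 // => /allP/(_ j); rewrite mem_index_enum => /(_ isT).
by rewrite !mxE mul_conjC_eq0 => /eqP.
Qed.

Lemma mul_adj_eq0 n (a : 'M[C]_n) : a *m a^t* = 0 -> a = 0.
Proof.
move=> aa; apply: (@sum_mul_adj_eq0 n 'I_1 (fun=> a)) ord0.
by rewrite big_ord1.
Qed.

End Adjoint.

(** * Tensor decompositions and multilinear maps *)

Section Tensors.
Variables (C : numClosedFieldType) (n : nat).
Local Notation M := 'M[C]_n.
Local Notation K := ('I_n * 'I_n)%type.
Implicit Types (V S T : 'M[C]_(n * n)) (W : lmodType C).

Lemma tensDl (a a' b : M) : (a + a') *t b = a *t b + a' *t b.
Proof. by apply/matrixP=> i j; rewrite !mxE mulrDl. Qed.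

Lemma tensDr (a b b' : M) : a *t (b + b') = a *t b + a *t b'.
Proof. by apply/matrixP=> i j; rewrite !mxE mulrDr. Qed.

Lemma tensZl c (a b : M) : (c *: a) *t b = c *: (a *t b).
Proof. by apply/matrixP=> i j; rewrite !mxE mulrA. Qed.

Lemma tensZr c (a b : M) : a *t (c *: b) = c *: (a *t b).
Proof. by apply/matrixP=> i j; rewrite !mxE mulrCA. Qed.

Lemma tens_suml (I : finType) (f : I -> M) (b : M) :
  (\sum_i f i) *t b = \sum_i f i *t b.
Proof.
exact: (big_morph (fun a => a *t b) (fun x y => tensDl x y b) (tens0mx b)).
Qed.

Lemma tens_sumr (I : finType) (a : M) (f : I -> M) :
  a *t (\sum_i f i) = \sum_i a *t f i.
Proof. exact: (big_morph (fun b => a *t b) (tensDr a) (tensmx0 a)). Qed.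

(** The matrix units, indexed by a single finite type so that a tensor
decomposition is a single sum. *)
Definition munit (u : K) : M := delta_mx u.1 u.2.

(** The coefficient of munit k in the right factor: the families lcoef V and
munit play the role of (A_k) and (B_k) in V = sum_k A_k (x) B_k, with the A_k
in the left leg of V. *)
Definition lcoef V (k : K) : M := blockl V k.1 k.2.

Lemma munit_expand (a : M) : a = \sum_u a u.1 u.2 *: munit u.
Proof. by rewrite [LHS]matrix_sum_delta pair_big. Qed.

Lemma tens_expandr V : V = \sum_k lcoef V k *t munit k.
Proof.
apply/matrixP=> i j; rewrite summxE.
case: (mxtens_indexP i) => i1 i2; case: (mxtens_indexP j) => j1 j2.
rewrite (bigD1 (i2, j2)) //= big1 => [|[k l] /eqP kl]; rewrite tensmxE !mxE /=.
  by rewrite !eqxx mulr1 addr0.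
by case: (i2 =P k) (j2 =P l) kl => [-> [->|]|] // _ _; rewrite mulr0.
Qed.

Lemma tens_expandl V : V = \sum_u munit u *t blockr V u.1 u.2.
Proof.
apply/matrixP=> i j; rewrite summxE.
case: (mxtens_indexP i) => i1 i2; case: (mxtens_indexP j) => j1 j2.
rewrite (bigD1 (i1, j1)) //= big1 => [|[k l] /eqP kl]; rewrite tensmxE !mxE /=.
  by rewrite !eqxx mul1r addr0.
by case: (i1 =P k) (j1 =P l) kl => [-> [->|]|] // _ _; rewrite mul0r.
Qed.

(** Additive statements about operators on H (x) H need only be checked on
elementary tensors. *)
Lemma tens_ind (P : 'M[C]_(n * n) -> Prop) :
  P 0 -> (forall S T, P S -> P T -> P (S + T)) -> (forall a b, P (a *t b)) ->
  forall T, P T.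
Proof. by move=> P0 PD Pt T; rewrite (tens_expandr T); apply: big_ind. Qed.

Definition idx3 (i j k : 'I_n) : 'I_(n * n * n) :=
  mxtens_index (mxtens_index (i, j), k).

Lemma tens3_ind (P : 'M[C]_(n * n * n) -> Prop) :
  P 0 -> (forall X Y, P X -> P Y -> P (X + Y)) ->
  (forall a b c, P (a *t b *t c)) -> forall X, P X.
Proof.
move=> P0 PD Pt X.
have -> : X = \sum_u \sum_v \sum_w
    (X (idx3 u.1 v.1 w.1) (idx3 u.2 v.2 w.2) *: munit u) *t munit v *t munit w.
  apply/matrixP=> i j.
  case: (mxtens_indexP i) => i12 i3; case: (mxtens_indexP j) => j12 j3.
  case: (mxtens_indexP i12) => i1 i2; case: (mxtens_indexP j12) => j1 j2.
  have d0 (x : K) a b : x != (a, b) -> munit x a b = 0.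
    case: x => x y; rewrite mxE /=.
    by case: (a =P x) => [<-|_] //=; case: (b =P y) => [<-|_] //=; rewrite eqxx.
  rewrite summxE (bigD1 (i1, j1)) //= [Z in _ + Z]big1 ?addr0 => [|u nu]; last first.
    rewrite summxE big1 // => v _; rewrite summxE big1 // => w _.
    by rewrite !tensmxE mxE (d0 _ _ _ nu) mulr0 !mul0r.
  rewrite summxE (bigD1 (i2, j2)) //= [Z in _ + Z]big1 ?addr0 => [|u nu]; last first.
    by rewrite summxE big1 // => w _; rewrite !tensmxE (d0 _ _ _ nu) mulr0 mul0r.
  rewrite summxE (bigD1 (i3, j3)) //= [Z in _ + Z]big1 ?addr0 => [|u nu]; last first.
    by rewrite !tensmxE (d0 _ _ _ nu) mulr0.
  by rewrite !tensmxE !mxE !eqxx !mulr1.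
apply: big_ind => // u _; apply: big_ind => // v _; exact: big_ind.
Qed.

(** The linear map on L(H (x) H (x) H) through which a trilinear f factors; it
is how an identity between three-leg operators is turned into an identity
between sums over coefficients. *)
Definition ext3 W (f : M -> M -> M -> W) (T : 'M[C]_(n * n * n)) : W :=
  \sum_u \sum_v \sum_w
    T (idx3 u.1 v.1 w.1) (idx3 u.2 v.2 w.2) *: f (munit u) (munit v) (munit w).

Definition trilinear W (f : M -> M -> M -> W) :=
  [/\ forall y z, linear (fun x => f x y z),
      forall x z, linear (fun y => f x y z) &
      forall x y, linear (fun z => f x y z)].

Lemma linear_munit W (g : M -> W) (a : M) :
  linear g -> g a = \sum_u a u.1 u.2 *: g (munit u).
Proof.
move=> lg; pose G : {linear M -> W} :=
  HB.pack g (GRing.isLinear.Build _ _ _ _ g lg).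
rewrite -[g]/(G : M -> W) {1}(munit_expand a) linear_sum.
by apply: eq_bigr => u _; rewrite linearZ.
Qed.

Lemma ext3_is_linear W (f : M -> M -> M -> W) : linear (ext3 f).
Proof.
move=> c S T; rewrite /ext3 scaler_sumr -big_split; apply: eq_bigr => u _ /=.
rewrite scaler_sumr -big_split; apply: eq_bigr => v _ /=.
rewrite scaler_sumr -big_split; apply: eq_bigr => w _ /=.
by rewrite !mxE scalerDl scalerA.
Qed.

HB.instance Definition _ W f :=
  GRing.isLinear.Build C 'M[C]_(n * n * n) W _ (ext3 f) (ext3_is_linear f).

Lemma ext3_tens W (f : M -> M -> M -> W) a b c :
  trilinear f -> ext3 f (a *t b *t c) = f a b c.
Proof.
case=> f1 f2 f3; rewrite (linear_munit a (f1 b c)); apply: eq_bigr => u _.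
rewrite (linear_munit b (f2 (munit u) c)) scaler_sumr; apply: eq_bigr => v _.
rewrite (linear_munit c (f3 (munit u) (munit v))) !scaler_sumr.
by apply: eq_bigr => w _; rewrite !tensmxE !scalerA.
Qed.

Lemma ext3_sum2 W (f : M -> M -> M -> W) (a b c : K -> K -> M) :
  trilinear f -> ext3 f (\sum_k \sum_l a k l *t b k l *t c k l) =
  \sum_k \sum_l f (a k l) (b k l) (c k l).
Proof.
move=> tf; rewrite linear_sum; apply: eq_bigr => k _; rewrite linear_sum.
by apply: eq_bigr => l _; rewrite /= ext3_tens.
Qed.

Lemma ext3_sum3 W (f : M -> M -> M -> W) (a b c : K -> K -> K -> M) :
  trilinear f -> ext3 f (\sum_j \sum_k \sum_l a j k l *t b j k l *t c j k l) =
  \sum_j \sum_k \sum_l f (a j k l) (b j k l) (c j k l).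
Proof.
move=> tf; rewrite linear_sum; apply: eq_bigr => j _.
by rewrite /= ext3_sum2.
Qed.

End Tensors.

(** * Leg numbering *)

Section Legs.
Variables (C : numClosedFieldType) (n : nat).
Local Notation M := 'M[C]_n.
Local Notation K := ('I_n * 'I_n)%type.
Implicit Types (V S T : 'M[C]_(n * n)).
Local Notation B := (munit C).

Lemma leg12_is_linear : linear (@leg12 C n).
Proof. by move=> c S T; apply/matrixP=> i j; rewrite !mxE mulrnDl mulrnAr. Qed.
Lemma leg13_is_linear : linear (@leg13 C n).
Proof. by move=> c S T; apply/matrixP=> i j; rewrite !mxE mulrnDl mulrnAr. Qed.
Lemma leg23_is_linear : linear (@leg23 C n).
Proof. by move=> c S T; apply/matrixP=> i j; rewrite !mxE mulrnDl mulrnAr. Qed.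

HB.instance Definition _ :=
  GRing.isLinear.Build C _ _ _ (@leg12 C n) leg12_is_linear.
HB.instance Definition _ :=
  GRing.isLinear.Build C _ _ _ (@leg13 C n) leg13_is_linear.
HB.instance Definition _ :=
  GRing.isLinear.Build C _ _ _ (@leg23 C n) leg23_is_linear.

Lemma leg12_adj V : leg12 (V^t*) = (leg12 V)^t*.
Proof. by apply/matrixP=> i j; rewrite !mxE rmorphMn eq_sym. Qed.
Lemma leg13_adj V : leg13 (V^t*) = (leg13 V)^t*.
Proof. by apply/matrixP=> i j; rewrite !mxE rmorphMn eq_sym. Qed.
Lemma leg23_adj V : leg23 (V^t*) = (leg23 V)^t*.
Proof. by apply/matrixP=> i j; rewrite !mxE rmorphMn eq_sym. Qed.

Lemma mulmx_tens_morph (phi : {linear 'M[C]_(n * n) -> 'M[C]_(n * n * n)}) :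
  (forall a b c d, phi ((a *t b) *m (c *t d)) = phi (a *t b) *m phi (c *t d)) ->
  forall V T, phi (V *m T) = phi V *m phi T.
Proof.
move=> phiM V T; elim/tens_ind: V => [|V V' IH IH'|a b].
- by rewrite mul0mx linear0 mul0mx.
- by rewrite mulmxDl !linearD mulmxDl -IH -IH'.
elim/tens_ind: T => [|T T' IH IH'|c d]; last exact: phiM.
- by rewrite mulmx0 linear0 mulmx0.
- by rewrite mulmxDr !linearD /= IH IH'.
Qed.

Lemma leg12M V T : leg12 (V *m T) = leg12 V *m leg12 T.
Proof.
apply: mulmx_tens_morph => a b c d /=.
by rewrite tensmx_mul !leg12_tens !tensmx_mul mulmx1.
Qed.
Lemma leg13M V T : leg13 (V *m T) = leg13 V *m leg13 T.
Proof.
apply: mulmx_tens_morph => a b c d /=.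
by rewrite tensmx_mul !leg13_tens !tensmx_mul mulmx1.
Qed.
Lemma leg23M V T : leg23 (V *m T) = leg23 V *m leg23 T.
Proof.
apply: mulmx_tens_morph => a b c d /=.
by rewrite tensmx_mul !leg23_tens !tensmx_mul mulmx1.
Qed.

Lemma leg12_r (y : M) : leg12 (1%:M *t y) = leg23 (y *t 1%:M).
Proof. by rewrite leg12_tens leg23_tens. Qed.
Lemma leg13_r (y : M) : leg13 (1%:M *t y) = leg23 (1%:M *t y).
Proof. by rewrite leg13_tens leg23_tens. Qed.

Lemma leg23_leg1_comm (a : M) V :
  leg23 V *m leg12 (a *t 1%:M) = leg12 (a *t 1%:M) *m leg23 V.
Proof.
elim/tens_ind: V => [|S T IS IT|x y].
- by rewrite linear0 mul0mx mulmx0.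
- by rewrite linearD /= mulmxDl mulmxDr IS IT.
- by rewrite leg12_tens leg23_tens !tensmx_mul !mul1mx !mulmx1.
Qed.
Lemma leg12_leg3_comm (b : M) V :
  leg23 (1%:M *t b) *m leg12 V = leg12 V *m leg23 (1%:M *t b).
Proof.
elim/tens_ind: V => [|S T IS IT|x y].
- by rewrite linear0 mul0mx mulmx0.
- by rewrite linearD /= mulmxDl mulmxDr IS IT.
- by rewrite leg12_tens leg23_tens !tensmx_mul !mul1mx !mulmx1.
Qed.

Lemma leg12E V : leg12 V = \sum_k lcoef V k *t B k *t 1%:M.
Proof.
rewrite {1}(tens_expandr V) linear_sum.
by apply: eq_bigr => k _ /=; rewrite leg12_tens.
Qed.
Lemma leg13E V : leg13 V = \sum_k lcoef V k *t 1%:M *t B k.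
Proof.
rewrite {1}(tens_expandr V) linear_sum.
by apply: eq_bigr => k _ /=; rewrite leg13_tens.
Qed.
Lemma leg23E V : leg23 V = \sum_k 1%:M *t lcoef V k *t B k.
Proof.
rewrite {1}(tens_expandr V) linear_sum.
by apply: eq_bigr => k _ /=; rewrite leg23_tens.
Qed.
Lemma leg12_adjE V : (leg12 V)^t* = \sum_k (lcoef V k)^t* *t (B k)^t* *t 1%:M.
Proof.
by rewrite leg12E adj_sum; apply: eq_bigr => k _; rewrite !adj_tens adj1.
Qed.
Lemma leg23_adjE V : (leg23 V)^t* = \sum_k 1%:M *t (lcoef V k)^t* *t (B k)^t*.
Proof.
by rewrite leg23E adj_sum; apply: eq_bigr => k _; rewrite !adj_tens adj1.
Qed.

Lemma mul_sum2 m (X Y : K -> 'M[C]_m) :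
  (\sum_k X k) *m (\sum_l Y l) = \sum_k \sum_l X k *m Y l.
Proof. by rewrite mulmx_suml; apply: eq_bigr => k _; rewrite mulmx_sumr. Qed.

Lemma mul_sum3 m (X Y Z : K -> 'M[C]_m) :
  (\sum_j X j) *m (\sum_k Y k) *m (\sum_l Z l) =
  \sum_j \sum_k \sum_l X j *m Y k *m Z l.
Proof.
rewrite mul_sum2 mulmx_suml; apply: eq_bigr => k _; rewrite mulmx_suml.
by apply: eq_bigr => l _; rewrite mulmx_sumr.
Qed.

Lemma leg13_leg23E V : leg13 V *m leg23 V =
  \sum_k \sum_l lcoef V k *t lcoef V l *t (B k *m B l).
Proof.
rewrite leg13E leg23E mul_sum2; apply: eq_bigr => k _; apply: eq_bigr => l _.
by rewrite !tensmx_mul mulmx1 mul1mx.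
Qed.

End Legs.

(** * Slices *)

Section Slices.
Variables (C : numClosedFieldType) (n : nat).
Local Notation M := 'M[C]_n.
Implicit Types (V S T X Y : 'M[C]_(n * n)) (w : {scalar M}).
Local Notation B := (munit C).

Lemma slicelP c S T w : slicel (c *: S + T) w = c *: slicel S w + slicel T w.
Proof.
apply/matrixP=> i j; rewrite !mxE -linearP; congr (w _).
by apply/matrixP=> k l; rewrite !mxE.
Qed.
Lemma slicel0 w : slicel (0 : 'M[C]_(n * n)) w = 0.
Proof. by have := slicelP (-1) 0 0 w; rewrite scaler0 addr0 scaleN1r addNr. Qed.
Lemma slicelD S T w : slicel (S + T) w = slicel S w + slicel T w.
Proof. by have := slicelP 1 S T w; rewrite !scale1r. Qed.
Lemma slicelZ c S w : slicel (c *: S) w = c *: slicel S w.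
Proof. by have := slicelP c S 0 w; rewrite slicel0 !addr0. Qed.
Lemma slicel_sum (I : finType) (T : I -> 'M[C]_(n * n)) w :
  slicel (\sum_i T i) w = \sum_i slicel (T i) w.
Proof.
exact: (big_morph (fun X => slicel X w) (fun S T => slicelD S T w) (slicel0 w)).
Qed.

Lemma slicerP c S T w : slicer (c *: S + T) w = c *: slicer S w + slicer T w.
Proof.
apply/matrixP=> i j; rewrite !mxE -linearP; congr (w _).
by apply/matrixP=> k l; rewrite !mxE.
Qed.
Lemma slicer0 w : slicer (0 : 'M[C]_(n * n)) w = 0.
Proof. by have := slicerP (-1) 0 0 w; rewrite scaler0 addr0 scaleN1r addNr. Qed.
Lemma slicerD S T w : slicer (S + T) w = slicer S w + slicer T w.
Proof. by have := slicerP 1 S T w; rewrite !scale1r. Qed.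
Lemma slicerZ c S w : slicer (c *: S) w = c *: slicer S w.
Proof. by have := slicerP c S 0 w; rewrite slicer0 !addr0. Qed.
Lemma slicer_sum (I : finType) (T : I -> 'M[C]_(n * n)) w :
  slicer (\sum_i T i) w = \sum_i slicer (T i) w.
Proof.
exact: (big_morph (fun X => slicer X w) (fun S T => slicerD S T w) (slicer0 w)).
Qed.

Lemma slicelE V w : slicel V w = \sum_k w (lcoef V k) *: B k.
Proof.
rewrite {1}(tens_expandr V) slicel_sum.
by apply: eq_bigr => k _; rewrite slicel_tens.
Qed.
Lemma slicerE V w : slicer V w = \sum_k w (B k) *: lcoef V k.
Proof.
rewrite {1}(tens_expandr V) slicer_sum.
by apply: eq_bigr => k _; rewrite slicer_tens.
Qed.

Lemma slicel_mulr V y w : slicel (V *m (1%:M *t y)) w = slicel V w *m y.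
Proof.
elim/tens_ind: V => [|S T IS IT|a b].
- by rewrite mul0mx slicel0 mul0mx.
- by rewrite mulmxDl !slicelD mulmxDl /= IS IT.
- by rewrite tensmx_mul mulmx1 !slicel_tens scalemxAl.
Qed.
Lemma slicel_mull V y w : slicel ((1%:M *t y) *m V) w = y *m slicel V w.
Proof.
elim/tens_ind: V => [|S T IS IT|a b].
- by rewrite mulmx0 slicel0 mulmx0.
- by rewrite mulmxDr !slicelD mulmxDr /= IS IT.
- by rewrite tensmx_mul mul1mx !slicel_tens scalemxAr.
Qed.
Lemma slicer_mulr V y w : slicer (V *m (y *t 1%:M)) w = slicer V w *m y.
Proof.
elim/tens_ind: V => [|S T IS IT|a b].
- by rewrite mul0mx slicer0 mul0mx.
- by rewrite mulmxDl !slicerD mulmxDl /= IS IT.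
- by rewrite tensmx_mul mulmx1 !slicer_tens scalemxAl.
Qed.
Lemma slicer_mull V y w : slicer ((y *t 1%:M) *m V) w = y *m slicer V w.
Proof.
elim/tens_ind: V => [|S T IS IT|a b].
- by rewrite mulmx0 slicer0 mulmx0.
- by rewrite mulmxDr !slicerD mulmxDr /= IS IT.
- by rewrite tensmx_mul mul1mx !slicer_tens scalemxAr.
Qed.

(** Every functional on L(H) has this form (scalar_trace_form), which makes
adjoints and products in the argument visible. *)
Definition trace_form (Z : M) : M -> C := mxtrace \o mulmx Z.
HB.instance Definition _ Z := GRing.Linear.on (trace_form Z).

Lemma trace_form_delta (i j : 'I_n) a : trace_form (delta_mx j i) a = a i j.
Proof.
rewrite /trace_form /= /mxtrace (bigD1 j) //= big1 => [|k kj]; rewrite mxE.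
  rewrite (bigD1 i) //= big1 => [|l li]; rewrite mxE ?eqxx ?mul1r ?addr0 //.
  by rewrite (negPf li) andbF mul0r.
by apply: big1 => l _; rewrite mxE (negPf kj) mul0r.
Qed.

Lemma slicel_delta V i j : slicel V (trace_form (delta_mx j i)) = blockr V i j.
Proof. by apply/matrixP=> k l; rewrite mxE /= trace_form_delta !mxE. Qed.
Lemma slicer_delta V i j : slicer V (trace_form (delta_mx j i)) = blockl V i j.
Proof. by apply/matrixP=> k l; rewrite mxE /= trace_form_delta !mxE. Qed.

Lemma slicel_inj S T : (forall w, slicel S w = slicel T w) -> S = T.
Proof.
move=> ST; apply/matrixP=> i j.
case: (mxtens_indexP i) => i1 i2; case: (mxtens_indexP j) => j1 j2.
have /matrixP/(_ i2 j2) := ST (trace_form (delta_mx j1 i1)).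
by rewrite !slicel_delta !mxE.
Qed.
Lemma slicer_inj S T : (forall w, slicer S w = slicer T w) -> S = T.
Proof.
move=> ST; apply/matrixP=> i j.
case: (mxtens_indexP i) => i1 i2; case: (mxtens_indexP j) => j1 j2.
have /matrixP/(_ i1 j1) := ST (trace_form (delta_mx j2 i2)).
by rewrite !slicer_delta !mxE.
Qed.

Lemma scalar_trace_form w : exists h, forall x, w x = trace_form h x.
Proof.
exists (\matrix_(j, i) w (delta_mx i j)) => x.
rewrite [in LHS](munit_expand x) linear_sum /trace_form /= /mxtrace.
rewrite -(pair_big xpredT xpredT (fun i j => w (x i j *: B (i, j)))) /=.
rewrite exchange_big; apply: eq_bigr => j _; rewrite mxE.
by apply: eq_bigr => i _; rewrite linearZ mxE mulrC.
Qed.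

Lemma eq_slicel V w w' : w =1 w' -> slicel V w = slicel V w'.
Proof. by move=> ww; apply/matrixP=> i j; rewrite !mxE ww. Qed.
Lemma eq_slicer V w w' : w =1 w' -> slicer V w = slicer V w'.
Proof. by move=> ww; apply/matrixP=> i j; rewrite !mxE ww. Qed.

Lemma right_legP V a :
  right_leg V a <-> exists Z, a = slicel V (trace_form Z).
Proof.
split=> [[w ->]|[Z ->]]; last by exists (trace_form Z).
by case: (scalar_trace_form w) => h wh; exists h; apply: eq_slicel.
Qed.
Lemma left_legP V a :
  left_leg V a <-> exists Z, a = slicer V (trace_form Z).
Proof.
split=> [[w ->]|[Z ->]]; last by exists (trace_form Z).
by case: (scalar_trace_form w) => h wh; exists h; apply: eq_slicer.
Qed.

Lemma left_leg_coef V k : left_leg V (lcoef V k).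
Proof. by exists (trace_form (delta_mx k.2 k.1)); rewrite slicer_delta. Qed.

Lemma slicel_linear V : linear (fun Z : M => slicel V (trace_form Z)).
Proof.
move=> c Y Z; apply/matrixP=> i j; rewrite !mxE /= /trace_form /=.
by rewrite mulmxDl -scalemxAl mxtraceD mxtraceZ.
Qed.
Lemma slicer_linear V : linear (fun Z : M => slicer V (trace_form Z)).
Proof.
move=> c Y Z; apply/matrixP=> i j; rewrite !mxE /= /trace_form /=.
by rewrite mulmxDl -scalemxAl mxtraceD mxtraceZ.
Qed.

Lemma slicel_mulr_form V y Z : slicel (V *m (y *t 1%:M)) (trace_form Z) =
  slicel V (trace_form (y *m Z)).
Proof.
elim/tens_ind: V => [|S T IS IT|a b].
- by rewrite mul0mx !slicel0.
- by rewrite mulmxDl !slicelD IS IT.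
- rewrite tensmx_mul mulmx1 !slicel_tens; congr (_ *: _).
  by rewrite /= /trace_form /= mulmxA mxtrace_mulC mulmxA.
Qed.
Lemma slicer_mull_form V y Z : slicer ((1%:M *t y) *m V) (trace_form Z) =
  slicer V (trace_form (Z *m y)).
Proof.
elim/tens_ind: V => [|S T IS IT|a b].
- by rewrite mulmx0 !slicer0.
- by rewrite mulmxDr !slicerD IS IT.
- by rewrite tensmx_mul mul1mx !slicer_tens /= /trace_form /= mulmxA.
Qed.

Lemma adj_expand V : V^t* = \sum_k (lcoef V k)^t* *t (B k)^t*.
Proof.
rewrite {1}(tens_expandr V) adj_sum.
by apply: eq_bigr => k _; rewrite adj_tens.
Qed.

Lemma slicel_star V Z :
  slicel (V^t*) (trace_form (Z^t*)) = (slicel V (trace_form Z))^t*.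
Proof.
rewrite adj_expand slicel_sum slicelE adj_sum; apply: eq_bigr => k _.
by rewrite slicel_tens adjZ /= /trace_form /= -mxtrace_adj adjM mxtrace_mulC.
Qed.
Lemma slicer_star V Z :
  slicer (V^t*) (trace_form (Z^t*)) = (slicer V (trace_form Z))^t*.
Proof.
rewrite adj_expand slicer_sum slicerE adj_sum; apply: eq_bigr => k _.
by rewrite slicer_tens adjZ /= /trace_form /= -mxtrace_adj adjM mxtrace_mulC.
Qed.

Lemma slicel_adj V Z : (slicel V (trace_form Z))^t* =
  \sum_k \tr ((lcoef V k)^t* *m Z^t*) *: (B k)^t*.
Proof.
rewrite slicelE adj_sum; apply: eq_bigr => k _.
by rewrite adjZ /= /trace_form /= -adjM mxtrace_adj.
Qed.
Lemma slicer_adj V Z : (slicer V (trace_form Z))^t* =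
  \sum_k \tr ((B k)^t* *m Z^t*) *: (lcoef V k)^t*.
Proof.
rewrite slicerE adj_sum; apply: eq_bigr => k _.
by rewrite adjZ /= /trace_form /= -adjM mxtrace_adj.
Qed.

Definition slice1 w := ext3 (fun a b c : M => w a *: (b *t c)).
Definition slice3 w := ext3 (fun a b c : M => w c *: (a *t b)).
HB.instance Definition _ w := GRing.Linear.on (slice1 w).
HB.instance Definition _ w := GRing.Linear.on (slice3 w).

Lemma slice1_tens w a b c : slice1 w (a *t b *t c) = w a *: (b *t c).
Proof.
apply: (ext3_tens (f := fun a b c : M => w a *: (b *t c))).
split=> x z d u v.
- by rewrite linearP scalerDl scalerA.
- by rewrite tensDl tensZl linearP.
- by rewrite tensDr tensZr linearP.
Qed.
Lemma slice3_tens w a b c : slice3 w (a *t b *t c) = w c *: (a *t b).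
Proof.
apply: (ext3_tens (f := fun a b c : M => w c *: (a *t b))).
split=> x z d u v.
- by rewrite tensDl tensZl linearP.
- by rewrite tensDr tensZr linearP.
- by rewrite linearP scalerDl scalerA.
Qed.

Lemma slice3_leg12l w X Z : slice3 w (leg12 X *m Z) = X *m slice3 w Z.
Proof.
elim/tens3_ind: Z => [|S T IS IT|a b c].
- by rewrite mulmx0 !linear0.
- by rewrite mulmxDr !linearD /= IS IT.
elim/tens_ind: X => [|S T IS IT|x y].
- by rewrite !linear0 !mul0mx linear0.
- by rewrite linearD !mulmxDl linearD /= IS IT.
- by rewrite leg12_tens !tensmx_mul mul1mx !slice3_tens -scalemxAr tensmx_mul.
Qed.
Lemma slice3_leg12r w X Z : slice3 w (Z *m leg12 X) = slice3 w Z *m X.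
Proof.
elim/tens3_ind: Z => [|S T IS IT|a b c].
- by rewrite mul0mx !linear0 mul0mx.
- by rewrite mulmxDl !linearD /= IS IT mulmxDl.
elim/tens_ind: X => [|S T IS IT|x y].
- by rewrite !linear0.
- by rewrite linearD !mulmxDr linearD /= IS IT.
- by rewrite leg12_tens !tensmx_mul mulmx1 !slice3_tens -scalemxAl tensmx_mul.
Qed.
Lemma slice1_leg23l w X Z : slice1 w (leg23 X *m Z) = X *m slice1 w Z.
Proof.
elim/tens3_ind: Z => [|S T IS IT|a b c].
- by rewrite mulmx0 !linear0.
- by rewrite mulmxDr !linearD /= IS IT.
elim/tens_ind: X => [|S T IS IT|x y].
- by rewrite !linear0 !mul0mx linear0.
- by rewrite linearD !mulmxDl linearD /= IS IT.
- by rewrite leg23_tens !tensmx_mul mul1mx !slice1_tens -scalemxAr tensmx_mul.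
Qed.
Lemma slice1_leg23r w X Z : slice1 w (Z *m leg23 X) = slice1 w Z *m X.
Proof.
elim/tens3_ind: Z => [|S T IS IT|a b c].
- by rewrite mul0mx !linear0 mul0mx.
- by rewrite mulmxDl !linearD /= IS IT mulmxDl.
elim/tens_ind: X => [|S T IS IT|x y].
- by rewrite !linear0.
- by rewrite linearD !mulmxDr linearD /= IS IT.
- by rewrite leg23_tens !tensmx_mul mulmx1 !slice1_tens -scalemxAl tensmx_mul.
Qed.

Lemma slice3_leg13 w X : slice3 w (leg13 X) = slicer X w *t 1%:M.
Proof.
elim/tens_ind: X => [|S T IS IT|x y].
- by rewrite !linear0 slicer0 tens0mx.
- by rewrite !linearD slicerD /= IS IT tensDl.
- by rewrite leg13_tens slice3_tens slicer_tens tensZl.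
Qed.
Lemma slice3_leg23 w X : slice3 w (leg23 X) = 1%:M *t slicer X w.
Proof.
elim/tens_ind: X => [|S T IS IT|x y].
- by rewrite !linear0 slicer0 tensmx0.
- by rewrite !linearD slicerD /= IS IT tensDr.
- by rewrite leg23_tens slice3_tens slicer_tens tensZr.
Qed.
Lemma slice1_leg12 w X : slice1 w (leg12 X) = slicel X w *t 1%:M.
Proof.
elim/tens_ind: X => [|S T IS IT|x y].
- by rewrite !linear0 slicel0 tens0mx.
- by rewrite !linearD slicelD /= IS IT tensDl.
- by rewrite leg12_tens slice1_tens slicel_tens tensZl.
Qed.
Lemma slice1_leg13 w X : slice1 w (leg13 X) = 1%:M *t slicel X w.
Proof.
elim/tens_ind: X => [|S T IS IT|x y].
- by rewrite !linear0 slicel0 tensmx0.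
- by rewrite !linearD slicelD /= IS IT tensDr.
- by rewrite leg13_tens slice1_tens slicel_tens tensZr.
Qed.

Lemma slicer_slice1 w w' Z : slicer (slice1 w Z) w' = slicel (slice3 w' Z) w.
Proof.
elim/tens3_ind: Z => [|X Y IX IY|a b c].
- by rewrite !linear0 slicel0 slicer0.
- by rewrite !linearD /= slicelD slicerD IX IY.
by rewrite slice1_tens slice3_tens slicerZ slicelZ slicel_tens slicer_tens
  !scalerA mulrC.
Qed.

(** The functional (w (x) w')(X (1 (x) x) Y).  For X = V^* and Y = V the map
x |-> X (1 (x) x) Y is the comultiplication of the left leg, and this is the
convolution product of functionals dual to it. *)
Definition convl X Y w w' (x : M) : C := w' (slicel (X *m (1%:M *t x) *m Y) w).

Lemma convl_linear X Y w w' : linear (convl X Y w w' : M -> C^o).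
Proof.
move=> c x y; rewrite /convl tensDr tensZr mulmxDr mulmxDl -scalemxAr -scalemxAl.
by rewrite slicelP linearP.
Qed.
HB.instance Definition _ X Y w w' :=
  GRing.isLinear.Build C M C^o _ (convl X Y w w') (convl_linear X Y w w').

(** The functional (w (x) w')(X (x (x) 1) Y); for X = V and Y = V^* the map
x |-> X (x (x) 1) Y is the comultiplication of the right leg. *)
Definition convr X Y w w' (x : M) : C := w (slicer (X *m (x *t 1%:M) *m Y) w').

Lemma convr_linear X Y w w' : linear (convr X Y w w' : M -> C^o).
Proof.
move=> c x y; rewrite /convr tensDl tensZl mulmxDr mulmxDl -scalemxAr -scalemxAl.
by rewrite slicerP linearP.
Qed.
HB.instance Definition _ X Y w w' :=
  GRing.isLinear.Build C M C^o _ (convr X Y w w') (convr_linear X Y w w').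

Lemma slice_convl X Y T w w' :
  slicel (slice1 w (leg12 X *m leg23 T *m leg12 Y)) w' =
  slicel T (convl X Y w w').
Proof.
elim/tens_ind: T => [|S T IS IT|a b].
- by rewrite linear0 mulmx0 mul0mx linear0 !slicel0.
- by rewrite linearD /= mulmxDr mulmxDl linearD /= !slicelD IS IT.
have -> : leg23 (a *t b) = leg12 (1%:M *t a) *m leg23 (1%:M *t b).
  by rewrite leg12_tens !leg23_tens !tensmx_mul !mul1mx mulmx1.
rewrite -!mulmxA leg12_leg3_comm !mulmxA -!leg12M slice1_leg23r slice1_leg12.
by rewrite tensmx_mul mul1mx mulmx1 !slicel_tens.
Qed.

Lemma slice_convr X Y T w w' :
  slicer (slice3 w' (leg23 X *m leg12 T *m leg23 Y)) w =
  slicer T (convr X Y w w').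
Proof.
elim/tens_ind: T => [|S T IS IT|a b].
- by rewrite linear0 mulmx0 mul0mx linear0 !slicer0.
- by rewrite linearD /= mulmxDr mulmxDl linearD /= !slicerD IS IT.
have -> : leg12 (a *t b) = leg12 (a *t 1%:M) *m leg23 (b *t 1%:M).
  by rewrite !leg12_tens leg23_tens !tensmx_mul !mul1mx !mulmx1.
rewrite mulmxA leg23_leg1_comm -!mulmxA -!leg23M slice3_leg12l slice3_leg23.
by rewrite tensmx_mul mul1mx mulmx1 !slicer_tens /= /convr mulmxA.
Qed.

Lemma right_unit V e : is_unit_for (right_leg V) e ->
  V *m (1%:M *t e) = V /\ (1%:M *t e) *m V = V.
Proof.
case=> _ ue; split; apply: slicel_inj => w; rewrite ?slicel_mulr ?slicel_mull.
  by case: (ue (slicel V w)) => //; exists w.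
by case: (ue (slicel V w)) => //; exists w.
Qed.

Lemma left_unit V e : is_unit_for (left_leg V) e ->
  V *m (e *t 1%:M) = V /\ (e *t 1%:M) *m V = V.
Proof.
case=> _ ue; split; apply: slicer_inj => w; rewrite ?slicer_mulr ?slicer_mull.
  by case: (ue (slicer V w)) => //; exists w.
by case: (ue (slicer V w)) => //; exists w.
Qed.

End Slices.

(** * The sandwich map *)

Section Sandwich.
Variables (C : numClosedFieldType) (n : nat).
Local Notation M := 'M[C]_n.
Implicit Types (V S T : 'M[C]_(n * n)) (X Y Z : M).
Local Notation B := (munit C).

Lemma sandwich_pure (a b X : M) : sandwich (a *t b) X = b *m X *m a.
Proof.
have := @sandwich_tens C n 1 (fun=> a) (fun=> b) X.
by rewrite !big_ord1.
Qed.

Lemma sandwichD S T X : sandwich (S + T) X = sandwich S X + sandwich T X.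
Proof.
rewrite /sandwich -big_split; apply: eq_bigr => i _.
rewrite -big_split; apply: eq_bigr => j _ /=.
rewrite -!mulmxDl; congr (_ *m _ *m _).
by apply/matrixP=> k l; rewrite !mxE.
Qed.

Lemma sandwich0 X : sandwich (0 : 'M[C]_(n * n)) X = 0.
Proof. by rewrite -{1}(tens0mx (0 : M)) sandwich_pure mulmx0. Qed.

Lemma sandwich_sum (I : finType) (T : I -> 'M[C]_(n * n)) X :
  sandwich (\sum_i T i) X = \sum_i sandwich (T i) X.
Proof.
exact: (big_morph (fun S => sandwich S X) (fun S T => sandwichD S T X)
  (sandwich0 X)).
Qed.

Lemma sandwichE V X : sandwich V X = \sum_k B k *m X *m lcoef V k.
Proof.
rewrite {1}(tens_expandr V) sandwich_sum.
by apply: eq_bigr => k _; rewrite sandwich_pure.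
Qed.

Lemma sandwich_mulr V X y : sandwich (V *m (y *t 1%:M)) X = sandwich V X *m y.
Proof.
elim/tens_ind: V => [|S T IS IT|a b].
- by rewrite mul0mx sandwich0 mul0mx.
- by rewrite mulmxDl !sandwichD mulmxDl IS IT.
- by rewrite tensmx_mul mulmx1 !sandwich_pure mulmxA.
Qed.

Lemma sandwich_mull V X y : sandwich ((1%:M *t y) *m V) X = y *m sandwich V X.
Proof.
elim/tens_ind: V => [|S T IS IT|a b].
- by rewrite mulmx0 sandwich0 mulmx0.
- by rewrite mulmxDr !sandwichD mulmxDr IS IT.
- by rewrite tensmx_mul mul1mx !sandwich_pure !mulmxA.
Qed.

Lemma mulmx_delta_entry (a b : M) (i j p q : 'I_n) :
  (b *m delta_mx i j *m a) p q = b p i * a j q.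
Proof.
have bd k : (b *m delta_mx i j) p k = b p i *+ (k == j).
  rewrite mxE (bigD1 i) //= big1 => [|c ci]; rewrite mxE.
    by rewrite eqxx addr0 mulr_natr.
  by rewrite (negPf ci) mulr0.
rewrite mxE (bigD1 j) //= big1 => [|k kj]; rewrite bd ?eqxx ?addr0 //.
by rewrite (negPf kj) mul0r.
Qed.

Lemma delta_conj (k : M) (i j p q : 'I_n) :
  delta_mx i j *m k *m delta_mx p q = k j p *: delta_mx i q.
Proof.
apply/matrixP=> a b; rewrite !mxE; under eq_bigr => c _.
  rewrite -[_ *m k]mul1mx mulmxA mulmx_delta_entry; over.
rewrite (bigD1 p) //= big1 => [|c cp]; rewrite !mxE.
  by rewrite eqxx addr0; case: (a == i); case: (b == q);
    rewrite ?(mul0r, mul1r, mulr0, mulr1).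
by rewrite (negPf cp) /= mulr0.
Qed.

Lemma sandwich_delta T i j p q :
  sandwich T (delta_mx i j) p q = T (idx2 j p) (idx2 q i).
Proof.
elim/tens_ind: T => [|S T IS IT|a b].
- by rewrite sandwich0 !mxE.
- by rewrite sandwichD !mxE IS IT.
- by rewrite sandwich_pure mulmx_delta_entry tensmxE mulrC.
Qed.

Lemma sandwich_inj S T : (forall X, sandwich S X = sandwich T X) -> S = T.
Proof.
move=> ST; apply/matrixP=> i j.
case: (mxtens_indexP i) => i1 i2; case: (mxtens_indexP j) => j1 j2.
have /matrixP/(_ i2 j1) := ST (delta_mx j2 i1).
by rewrite !sandwich_delta.
Qed.

(** Averaging over the matrix units turns a matrix in the middle of a product
into its trace. *)
Lemma sum_munit_conj (T : M) : \sum_u B u *m T *m (B u)^T = (\tr T)%:M.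
Proof.
rewrite -(pair_big xpredT xpredT (fun i j => B (i, j) *m T *m (B (i, j))^T)) /=.
transitivity (\sum_(i < n) \tr T *: delta_mx i i : M).
  apply: eq_bigr => i _; rewrite /mxtrace scaler_suml; apply: eq_bigr => j _.
  by rewrite /munit trmx_delta delta_conj.
rewrite -scaler_sumr -scalemx1; congr (_ *: _).
apply/matrixP=> i j; rewrite summxE mxE (bigD1 i) //= big1 => [|k ki].
  by rewrite mxE eqxx addr0 eq_sym.
by rewrite mxE [i == k]eq_sym (negPf ki).
Qed.

End Sandwich.

(** * Consequences of the axioms *)

Section MPI.
Variables (C : numClosedFieldType) (n : nat) (V : 'M[C]_(n * n)).
Local Notation M := 'M[C]_n.
Hypothesis hV : MPI V.
Local Notation V12 := (leg12 V).
Local Notation V13 := (leg13 V).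
Local Notation V23 := (leg23 V).
Local Notation A := (lcoef V).
Local Notation B := (munit C).

Lemma mpi_partial_isometry : V *m V^t* *m V = V. Proof. by case: hV. Qed.

Let VVV := mpi_partial_isometry.
Let pentagon : V23 *m V12 = V12 *m V13 *m V23. Proof. by case: hV. Qed.
Let src_rg : V13 *m V23 *m V23^t* = V12^t* *m V12 *m V13.
Proof. by case: hV. Qed.
Let rg_comm : V12 *m V12^t* *m V23 = V23 *m V12 *m V12^t*.
Proof. by case: hV. Qed.
Let src_comm : V12 *m V23^t* *m V23 = V23^t* *m V23 *m V12.
Proof. by case: hV. Qed.
Let V12K : V12 *m V12^t* *m V12 = V12.
Proof. by rewrite -leg12_adj -!leg12M VVV. Qed.
Let V23K : V23 *m V23^t* *m V23 = V23.
Proof. by rewrite -leg23_adj -!leg23M VVV. Qed.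
Let V23Ks : V23^t* *m V23 *m V23^t* = V23^t*.
Proof. by rewrite -[in RHS]V23K !adjM trmxCK mulmxA. Qed.
Let V12Ks : V12^t* *m V12 *m V12^t* = V12^t*.
Proof. by rewrite -[in RHS]V12K !adjM trmxCK mulmxA. Qed.

Lemma mpi_comult_left : V13 *m V23 = V12^t* *m V23 *m V12.
Proof.
by rewrite -mulmxA pentagon !mulmxA -src_rg -!mulmxA (mulmxA V23) V23K.
Qed.

Lemma mpi_comult_right : V12 *m V13 = V23 *m V12 *m V23^t*.
Proof. by rewrite pentagon -!mulmxA (mulmxA V13) src_rg !mulmxA V12K. Qed.

Lemma mpi_mixed_left : V12 *m V23^t* = V23^t* *m V12 *m V13.
Proof.
by rewrite -[in RHS]mulmxA mpi_comult_right !mulmxA -src_comm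
  -!(mulmxA V12) V23Ks.
Qed.

Lemma mpi_mixed_right : V12^t* *m V23 = V13 *m V23 *m V12^t*.
Proof.
by rewrite mpi_comult_left -!mulmxA (mulmxA V23) -rg_comm !mulmxA V12Ks.
Qed.

Lemma mpi_source_range :
  leg12 (V^t* *m V) *m V13 = V13 *m leg23 (V *m V^t*).
Proof. by rewrite leg12M leg23M leg12_adj leg23_adj mulmxA src_rg. Qed.

Lemma mpi_range_comm : leg12 (V *m V^t*) *m V23 = V23 *m leg12 (V *m V^t*).
Proof. by rewrite leg12M leg12_adj rg_comm mulmxA. Qed.

Lemma mpi_source_intertwine :
  V23 *m leg12 (V^t* *m V) = leg13 (V^t* *m V) *m V23.
Proof.
have E : V13^t* *m V12^t* = V23 *m V12^t* *m V23^t*.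
  by rewrite -adjM mpi_comult_right !adjM trmxCK mulmxA.
have sc : V23^t* *m V23 *m V12^t* = V12^t* *m (V23^t* *m V23).
  have := congr1 (fun T => T^t*) src_comm.
  by rewrite -mulmxA !adjM !trmxCK => <-.
rewrite leg12M leg13M leg12_adj leg13_adj -[in RHS]mulmxA mpi_comult_left.
rewrite !mulmxA E.
transitivity (V23 *m (V12^t* *m (V23^t* *m V23)) *m V12).
  by rewrite -sc !mulmxA V23K.
by rewrite !mulmxA.
Qed.

(** Elements of A^R can be moved across V, so that the sandwich map takes its
values in the commutant of A^R. *)
Lemma source_intertwine a : source_right_leg V a ->
  V *m (a *t 1%:M) = (1%:M *t a) *m V.
Proof.
case=> w ->; have := congr1 (slice1 w) mpi_source_intertwine.
by rewrite slice1_leg23l slice1_leg23r slice1_leg12 slice1_leg13.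
Qed.

Lemma coef_mixed_left (W : lmodType C) (f : M -> M -> M -> W) :
  trilinear f ->
  \sum_k \sum_l f (A k) (B k *m (A l)^t*) ((B l)^t*) =
  \sum_j \sum_k \sum_l f (A k *m A l) ((A j)^t* *m B k) ((B j)^t* *m B l).
Proof.
move=> tf; rewrite -ext3_sum2 // -ext3_sum3 //; congr (ext3 f _).
transitivity (V12 *m V23^t*).
  rewrite leg12E leg23_adjE mul_sum2.
  apply: eq_bigr => k _; apply: eq_bigr => l _.
  by rewrite !tensmx_mul mulmx1 mul1mx.
rewrite mpi_mixed_left leg23_adjE leg13E leg12E mul_sum3.
apply: eq_bigr => j _; apply: eq_bigr => k _; apply: eq_bigr => l _.
by rewrite !tensmx_mul !mulmx1 !mul1mx.
Qed.

Lemma coef_mixed_right (W : lmodType C) (f : M -> M -> M -> W) :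
  trilinear f ->
  \sum_k \sum_l f ((A k)^t*) ((B k)^t* *m A l) (B l) =
  \sum_j \sum_k \sum_l f (A j *m (A l)^t*) (A k *m (B l)^t*) (B j *m B k).
Proof.
move=> tf; rewrite -ext3_sum2 // -ext3_sum3 //; congr (ext3 f _).
transitivity (V12^t* *m V23).
  rewrite leg12_adjE leg23E mul_sum2.
  apply: eq_bigr => k _; apply: eq_bigr => l _.
  by rewrite !tensmx_mul mulmx1 mul1mx.
rewrite mpi_mixed_right leg12_adjE leg13E leg23E mul_sum3.
apply: eq_bigr => j _; apply: eq_bigr => k _; apply: eq_bigr => l _.
by rewrite !tensmx_mul !mulmx1 !mul1mx.
Qed.

Lemma slicel_mul w w' :
  slicel V w *m slicel V w' = slicel V (convl (V^t*) V w w').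
Proof.
rewrite -slice_convl leg12_adj -mpi_comult_left.
by rewrite slice1_leg23r slice1_leg13 slicel_mull.
Qed.

Lemma slicer_mul w w' :
  slicer V w *m slicer V w' = slicer V (convr V (V^t*) w w').
Proof.
rewrite -slice_convr leg23_adj -mpi_comult_right.
by rewrite slice3_leg12l slice3_leg13 slicer_mulr.
Qed.

Lemma slicer_adj_mul w w' :
  slicer (V^t*) w' *m slicer (V^t*) w = slicer (V^t*) (convr V (V^t*) w w').
Proof.
rewrite -slice_convr leg12_adj leg23_adj -{1}[V23]trmxCK -mulmxA -!adjM.
have -> : V23 *m V12 *m V23^t* = V12 *m V13 by rewrite mpi_comult_right.
by rewrite adjM -leg12_adj -leg13_adj slice3_leg12r slice3_leg13 slicer_mull.
Qed.

Lemma right_leg_subalgebra : is_subalgebra (right_leg V).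
Proof.
split.
- exists (trace_form 0); apply/matrixP=> i j.
  by rewrite !mxE /= /trace_form /= mul0mx mxtrace0.
- move=> c a b /right_legP[Y ->] /right_legP[Z ->].
  by exists (trace_form (c *: Y + Z)); rewrite slicel_linear.
- by move=> a b [v ->] [w ->]; rewrite slicel_mul; eexists.
Qed.

Lemma left_leg_subalgebra : is_subalgebra (left_leg V).
Proof.
split.
- exists (trace_form 0); apply/matrixP=> i j.
  by rewrite !mxE /= /trace_form /= mul0mx mxtrace0.
- move=> c a b /left_legP[Y ->] /left_legP[Z ->].
  by exists (trace_form (c *: Y + Z)); rewrite slicer_linear.
- by move=> a b [v ->] [w ->]; rewrite slicer_mul; eexists.
Qed.

(** * Units of the legs *)

Section Units.
Variables (we wf : {scalar M}).
Let e := slicel V we.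
Let f := slicer V wf.
Hypothesis ue : is_unit_for (right_leg V) e.
Hypothesis uf : is_unit_for (left_leg V) f.
Local Notation P := (V^t* *m V).
Local Notation Q := (V *m V^t*).

Let Ver : V *m (1%:M *t e) = V. Proof. by case: (right_unit ue). Qed.
Let Vel : (1%:M *t e) *m V = V. Proof. by case: (right_unit ue). Qed.
Let Vfr : V *m (f *t 1%:M) = V. Proof. by case: (left_unit uf). Qed.
Let Vfl : (f *t 1%:M) *m V = V. Proof. by case: (left_unit uf). Qed.
Let VP : V *m P = V. Proof. by rewrite mulmxA VVV. Qed.

(** Slicing the third leg of P12 V13 = V13 Q23 shows that the right leg of P is
contained in the left leg of Q. *)
Let PE : P = slice3 wf (V13 *m leg23 Q).
Proof.
by rewrite -mpi_source_range slice3_leg12l slice3_leg13 -mulmxA Vfr.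
Qed.

(** Slicing the first leg of the same identity gives the reverse inclusion, and
also shows that the right leg of Q is contained in A. *)
Let QE : Q = slice1 we (leg12 P *m V13).
Proof. by rewrite mpi_source_range slice1_leg23r slice1_leg13 mulmxA Vel. Qed.

Lemma source_absorbs y : Q *m (y *t 1%:M) = Q -> P *m (1%:M *t y) = P.
Proof.
by move=> Qy; rewrite {1}PE -slice3_leg12r leg12_r -mulmxA -leg23M Qy -PE.
Qed.

Lemma range_absorbs y : (1%:M *t y) *m P = P -> (y *t 1%:M) *m Q = Q.
Proof.
by move=> Py; rewrite {1}QE -slice1_leg23l -leg12_r mulmxA -leg12M Py -QE.
Qed.

Lemma range_right_unit : Q *m (1%:M *t e) = Q.
Proof. by rewrite {1}QE -slice1_leg23r -leg13_r -mulmxA -leg13M Ver -QE. Qed.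

Lemma range_comm_left_unit : Q *m (1%:M *t f) = (1%:M *t f) *m Q.
Proof.
have := congr1 (slice3 wf) mpi_range_comm.
by rewrite slice3_leg12l slice3_leg12r slice3_leg23.
Qed.

(** As Q is self-adjoint and absorbs f on the left, it absorbs f^* on the right;
source_absorbs transports this to P, and thence to V = V P. *)
Lemma right_adj_left_unit : V *m (1%:M *t f^t*) = V.
Proof.
rewrite -[in LHS]VP -mulmxA source_absorbs ?VP //.
have Qs : Q^t* = Q by rewrite adjM trmxCK.
have fQ : (f *t 1%:M) *m Q = Q by rewrite mulmxA Vfl.
by rewrite -[in RHS]Qs -[in RHS]fQ adjM Qs adj_tens adj1.
Qed.

Lemma left_adj_right_unit : (e^t* *t 1%:M) *m V = V.
Proof.
rewrite -[in LHS]VVV mulmxA range_absorbs ?VVV //.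
have Ps : P^t* = P by rewrite adjM trmxCK.
have Pe : P *m (1%:M *t e) = P by rewrite -mulmxA Ver.
by rewrite -[in RHS]Ps -[in RHS]Pe adjM Ps adj_tens adj1.
Qed.

Lemma unit_eq_of_sandwich :
  V *m (e *t 1%:M) = V -> f = e /\ e^t* = e.
Proof.
move=> Ve.
have efs : e *m f^t* = e by rewrite -slicel_mulr right_adj_left_unit.
have fe : f *m e = f by rewrite -slicer_mulr Ve.
have ff : f = f *m f^t* by rewrite -{1}fe -{1}efs mulmxA fe.
have fs : f^t* = f by rewrite [in LHS]ff adjM trmxCK -ff.
rewrite fs in efs.
(* Q (1 (x) f) = Q because e f = e; as f commutes with the right leg of Q, it
   is also absorbed on the left by Q, hence by V = Q V. *)
have Vf : (1%:M *t f) *m V = V.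
  rewrite -{1}VVV mulmxA -range_comm_left_unit -range_right_unit.
  by rewrite -[X in X *m _]mulmxA tensmx_mul mulmx1 efs range_right_unit VVV.
have fe' : f *m e = e by rewrite -slicel_mull Vf.
have -> : f = e by rewrite -fe fe'.
by split=> //; rewrite -fe' fe.
Qed.

End Units.

(** * Unital and regular implies adjoint-closed *)

Section Adjoint.
Hypothesis C_adj : forall X, exists X', (sandwich V X)^t* = sandwich V X'.
Variables (we wf : {scalar M}) (e : M).
Hypotheses (ee : e = slicel V we) (ef : e = slicer V wf) (es : e^t* = e).
Hypotheses (Ve : V *m (e *t 1%:M) = V) (eV : (1%:M *t e) *m V = V).

(** A general element of A^*, in terms of Z. *)
Let L (Z : M) := \sum_k \tr ((A k)^t* *m Z) *: (B k)^t*.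
Let H (c Y : M) := \sum_j \sum_l
  \tr ((A j)^t* *m c *m A l *m Y) *: ((B j)^t* *m B l).

Let H_adj c Y : (H c Y)^t* = H (c^t*) (Y^t*).
Proof.
rewrite /H adj_sum; under eq_bigr => j _ do rewrite adj_sum.
rewrite exchange_big; apply: eq_bigr => j _; apply: eq_bigr => l _ /=.
rewrite adjZ -mxtrace_adj !adjM !trmxCK; congr (_ *: _).
by rewrite mxtrace_mulC !mulmxA.
Qed.

Let LH X Y : L (\sum_k X *m A k *m Y *m B k) = H (sandwich V X) Y.
Proof.
pose g (a b c : M) := \tr (b *m X *m a *m Y) *: c.
have tg : trilinear g.
  split=> x y c u v; rewrite /g.
  - by rewrite mulmxDr mulmxDl -scalemxAr -scalemxAl mxtraceD mxtraceZ
      scalerDl scalerA.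
  - by rewrite !mulmxDl -!scalemxAl mxtraceD mxtraceZ scalerDl scalerA.
  - by rewrite scalerDr !scalerA mulrC.
have := coef_mixed_left tg; rewrite /g => E.
transitivity (\sum_k \sum_l
    \tr (B k *m (A l)^t* *m X *m A k *m Y) *: (B l)^t*).
  rewrite /L exchange_big; apply: eq_bigr => l _; rewrite -scaler_suml.
  congr (_ *: _); rewrite mulmx_sumr linear_sum; apply: eq_bigr => k _ /=.
  by rewrite -!mulmxA [in RHS]mxtrace_mulC !mulmxA.
rewrite E; apply: eq_bigr => j _; rewrite exchange_big; apply: eq_bigr => l _ /=.
rewrite -scaler_suml; congr (_ *: _); rewrite sandwichE mulmx_sumr !mulmx_suml.
by rewrite linear_sum; apply: eq_bigr => k _; rewrite !mulmxA.
Qed.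

Let LD Y Z : L (Y + Z) = L Y + L Z.
Proof.
rewrite /L -big_split; apply: eq_bigr => k _ /=.
by rewrite mulmxDr linearD scalerDl.
Qed.
Let L0 : L 0 = 0.
Proof. by rewrite /L big1 // => k _; rewrite mulmx0 linear0 scale0r. Qed.

(** Every element of A^* is L (Z e) for some Z, and Z e is a sum of arguments
to which LH applies, because e is itself a slice of V. *)
Lemma right_leg_adj a : right_leg V a -> right_leg V (a^t*).
Proof.
have LE Z : L Z = (slicel V (trace_form (Z^t*)))^t* by rewrite slicel_adj trmxCK.
have Le Z : L Z = L (Z *m e).
  by rewrite !LE -[in LHS]Ve slicel_mulr_form adjM es.
suff Ladj Z : exists Z', (L Z)^t* = L Z'.
  case/right_legP=> Z ->; case: (Ladj (Z^t*)) => Z'.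
  rewrite LE !trmxCK => ->; rewrite LE trmxCK.
  by exists (trace_form (Z'^t*)).
rewrite Le; case: (scalar_trace_form we) => h hwe.
have -> : Z *m e =
    \sum_u \sum_k (Z *m B u) *m A k *m (h *m (B u)^T) *m B k.
  rewrite exchange_big ee slicelE mulmx_sumr; apply: eq_bigr => k _.
  rewrite -mulmx_suml.
  transitivity (Z *m (\sum_u B u *m (A k *m h) *m (B u)^T) *m B k).
    rewrite sum_munit_conj mul_mx_scalar hwe /= /trace_form /= mxtrace_mulC.
    by rewrite -scalemxAr scalemxAl.
  congr (_ *m _); rewrite mulmx_sumr.
  by apply: eq_bigr => u _; rewrite !mulmxA.
rewrite (big_morph L LD L0) adj_sum.
apply: (big_ind (fun x => exists Z', x = L Z')) => [|x y [X ->] [Y ->]|u _].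
- by exists 0.
- by exists (X + Y).
rewrite LH H_adj; case: (C_adj (Z *m B u)) => X' ->; rewrite -LH.
by eexists.
Qed.

Let Ll (Z : M) := \sum_k \tr ((B k)^t* *m Z) *: (A k)^t*.
Let Hl (c Y : M) := \sum_j \sum_l
  \tr (B j *m c *m (B l)^t* *m Y) *: (A j *m (A l)^t*).

Let Hl_adj c Y : (Hl c Y)^t* = Hl (c^t*) (Y^t*).
Proof.
rewrite /Hl adj_sum; under eq_bigr => j _ do rewrite adj_sum.
rewrite exchange_big; apply: eq_bigr => j _; apply: eq_bigr => l _ /=.
rewrite adjZ -mxtrace_adj !adjM !trmxCK; congr (_ *: _).
by rewrite mxtrace_mulC !mulmxA.
Qed.

Let LHl X Y : Ll (\sum_k A k *m Y *m B k *m X) = Hl (sandwich V X) Y.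
Proof.
pose g (a b c : M) := \tr (c *m X *m b *m Y) *: a.
have tg : trilinear g.
  split=> x y c u v; rewrite /g.
  - by rewrite scalerDr !scalerA mulrC.
  - by rewrite mulmxDr mulmxDl -scalemxAr -scalemxAl mxtraceD mxtraceZ
      scalerDl scalerA.
  - by rewrite !mulmxDl -!scalemxAl mxtraceD mxtraceZ scalerDl scalerA.
have := coef_mixed_right tg; rewrite /g => E.
transitivity (\sum_k \sum_l
    \tr (B l *m X *m ((B k)^t* *m A l) *m Y) *: (A k)^t*).
  rewrite /Ll; apply: eq_bigr => k _; rewrite -scaler_suml.
  congr (_ *: _); rewrite mulmx_sumr linear_sum; apply: eq_bigr => l _ /=.
  by rewrite [in RHS]mulmxA -!(mulmxA (B l *m X)) [in RHS]mxtrace_mulC !mulmxA.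
rewrite E; apply: eq_bigr => j _; rewrite exchange_big; apply: eq_bigr => l _ /=.
rewrite -scaler_suml; congr (_ *: _); rewrite sandwichE mulmx_sumr !mulmx_suml.
by rewrite linear_sum; apply: eq_bigr => k _; rewrite !mulmxA.
Qed.

Let LlD Y Z : Ll (Y + Z) = Ll Y + Ll Z.
Proof.
rewrite /Ll -big_split; apply: eq_bigr => k _ /=.
by rewrite mulmxDr linearD scalerDl.
Qed.
Let Ll0 : Ll 0 = 0.
Proof. by rewrite /Ll big1 // => k _; rewrite mulmx0 linear0 scale0r. Qed.

(** The mirror image of right_leg_adj, with e written as a slice of V on the
other side. *)
Lemma left_leg_adj a : left_leg V a -> left_leg V (a^t*).
Proof.
have LE Z : Ll Z = (slicer V (trace_form (Z^t*)))^t*.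
  by rewrite slicer_adj trmxCK.
have Le Z : Ll Z = Ll (e *m Z).
  by rewrite !LE -[in LHS]eV slicer_mull_form adjM es.
suff Ladj Z : exists Z', (Ll Z)^t* = Ll Z'.
  case/left_legP=> Z ->; case: (Ladj (Z^t*)) => Z'.
  rewrite LE !trmxCK => ->; rewrite LE trmxCK.
  by exists (trace_form (Z'^t*)).
rewrite Le; case: (scalar_trace_form wf) => h hwf.
have -> : e *m Z =
    \sum_u \sum_k A k *m B u *m B k *m (h *m (B u)^T *m Z).
  rewrite exchange_big ef slicerE mulmx_suml; apply: eq_bigr => k _.
  transitivity (A k *m (\sum_u B u *m (B k *m h) *m (B u)^T) *m Z).
    rewrite sum_munit_conj mul_mx_scalar hwf /= /trace_form /= mxtrace_mulC.
    by rewrite -scalemxAl.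
  rewrite mulmx_sumr mulmx_suml.
  by apply: eq_bigr => u _; rewrite !mulmxA.
rewrite (big_morph Ll LlD Ll0) adj_sum.
apply: (big_ind (fun x => exists Z', x = Ll Z')) => [|x y [X ->] [Y ->]|u _].
- by exists 0.
- by exists (X + Y).
rewrite LHl Hl_adj; case: (C_adj (h *m (B u)^T *m Z)) => X' ->; rewrite -LHl.
by eexists.
Qed.

End Adjoint.

Lemma unital_regular_star :
  unital V -> regular V ->
  is_star_subalgebra (right_leg V) /\ is_star_subalgebra (left_leg V).
Proof.
case=> wf [we [ue uf]] [e [eA eu] CV].
have ee : e = slicel V we.
  case: ue => wA wu.
  by rewrite -(proj2 (wu e eA)) (proj1 (eu _ wA)).
have Ve : V *m (e *t 1%:M) = V.
  apply: sandwich_inj => X; rewrite sandwich_mulr.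
  have /CV[_ [Y ->]] : calC V (sandwich V X) by exists X.
  by rewrite -mulmxA (proj1 (eu e eA)).
have [ef es] : slicer V wf = e /\ e^t* = e.
  by rewrite ee; apply: unit_eq_of_sandwich; rewrite // -ee.
have eV : (1%:M *t e) *m V = V by case: (right_unit (conj eA eu)).
have srcs a : source_right_leg V a -> source_right_leg V (a^t*).
  case/right_legP=> Z ->.
  exists (trace_form (Z^t*)); rewrite -slicel_star; congr (slicel _ _).
  by rewrite adjM trmxCK.
have C_adj X : exists X', (sandwich V X)^t* = sandwich V X'.
  apply/CV; have /CV[cX [Y XY]] : calC V (sandwich V X) by exists X.
  split; last by exists (Y^t*); rewrite XY !adjM es mulmxA.
  move=> a /srcs/cX /(congr1 (fun x => x^t*)).
  by rewrite !adjM trmxCK => ->.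
split; split.
- exact: right_leg_subalgebra.
- move=> a; exact: (right_leg_adj C_adj ee).
- exact: left_leg_subalgebra.
- move=> a; exact: (left_leg_adj C_adj (esym ef)).
Qed.

End MPI.

(** * Units of finite dimensional *-algebras *)

Section StarUnit.
Variables (C : numClosedFieldType) (n : nat).
Local Notation M := 'M[C]_n.

(** Let h be the sum of x x^* over a basis of U.  If y h = 0 then positivity
gives y x = 0 for all basis elements, so y annihilates U.  Hence right
multiplication by h is injective on U, and by finite dimension h = e h for some
e in U; then 1 - e annihilates U as well, so e is a left unit, and e^* is a
right unit. *)
Lemma star_algebra_unit (U : {vspace M}) :
  {in U &, forall a b, a *m b \in U} -> {in U, forall a, a^t* \in U} ->
  exists e, [/\ e \in U, e^t* = e & {in U, forall a, e *m a = a /\ a *m e = a}].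
Proof.
move=> UM Ustar; pose x (i : 'I_(\dim U)) := (vbasis U)`_i.
have xU i : x i \in U by apply/vbasis_mem/mem_nth; rewrite size_tuple.
pose h := \sum_i x i *m (x i)^t*.
have hU : h \in U by apply: memv_suml => i _; apply: UM => //; exact: Ustar.
have h0 (y : M) : y *m h = 0 -> {in U, forall a, y *m a = 0}.
  move=> yh; have yx : forall i, y *m x i = 0.
    apply: (sum_mul_adj_eq0 (X := fun i => y *m x i)).
    transitivity (y *m h *m y^t*); last by rewrite yh mul0mx.
    rewrite /h mulmx_sumr mulmx_suml; apply: eq_bigr => i _.
    by rewrite adjM !mulmxA.
  move=> a /coord_vbasis ->; rewrite mulmx_sumr big1 // => i _.
  by rewrite -scalemxAr yx scaler0.
pose f := linfun (mulmxr h : M -> M).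
have fU : (f @: U <= U)%VS.
  apply/subvP=> _ /memv_imgP[a aU ->]; rewrite lfunE /=; exact: UM.
have fU0 : (U :&: lker f = 0)%VS.
  apply/eqP; rewrite -subv0; apply/subvP=> a /memv_capP[aU].
  rewrite memv_ker lfunE /= => /eqP/h0 a0.
  by rewrite memv0; apply/eqP/mul_adj_eq0/a0/Ustar.
have : h \in (f @: U)%VS.
  suff -> : (f @: U = U)%VS by [].
  by apply/eqP; rewrite eqEdim fU (limg_dim_eq fU0) leqnn.
case/memv_imgP=> e eU; rewrite lfunE /= => eh.
have el a : a \in U -> e *m a = a.
  move=> aU; apply/eqP; rewrite -subr_eq0 -[X in _ - X]mul1mx -mulmxBl.
  by apply/eqP; apply: h0 => //; rewrite mulmxBl mul1mx -eh subrr.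
have er a : a \in U -> a *m e^t* = a.
  by move=> /Ustar/el/(congr1 (fun b => b^t*)); rewrite adjM !trmxCK.
have es : e^t* = e by rewrite -[RHS]er // el // Ustar.
by exists e; split=> // a aU; split; [exact: el | rewrite -[X in _ *m X]es er].
Qed.

Lemma star_subalgebra_unit (S : M -> Prop) (phi : M -> M) :
  linear phi -> (forall a, S a <-> exists Z, a = phi Z) ->
  is_star_subalgebra S -> exists e, is_unit_for S e /\ e^t* = e.
Proof.
move=> lin SE [[_ _ SM] Sstar].
pose psi : {linear M -> M} := HB.pack phi (GRing.isLinear.Build _ _ _ _ phi lin).
pose U := limg (linfun psi).
have UE a : a \in U <-> S a.
  split=> [/memv_imgP[Z _ ->]|/SE[Z ->]]; first by apply/SE; exists Z; rewrite lfunE.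
  by apply/memv_imgP; exists Z; rewrite ?memvf // lfunE.
case: (@star_algebra_unit U) => [a b /UE Sa /UE Sb|a /UE Sa|].
- exact/UE/SM.
- exact/UE/Sstar.
move=> e [/UE Se es eu]; exists e; split=> //; split=> // a /UE; exact: eu.
Qed.

End StarUnit.

(** * Adjoint-closed implies regular *)

Section Antipode.
Variables (C : numClosedFieldType) (n : nat) (V : 'M[C]_(n * n)).
Local Notation M := 'M[C]_n.
Local Notation A := (lcoef V).
Local Notation B := (munit C).
Local Notation K := ('I_n * 'I_n)%type.
Hypothesis hV : MPI V.

(** The entries of F are the functionals representing the right coefficients of
V, which lie in A = A^*, as slices of V^*. *)
Lemma antipode_exists : (forall a, right_leg V a -> right_leg V (a^t*)) ->
  exists F : {linear M -> M}, V = \sum_k F ((A k)^t*) *t (B k)^t*.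
Proof.
move=> Astar.
have /fin_all_exists[Z ZE] (u : K) :
    exists Z, (blockr V u.1 u.2)^t* = slicel V (trace_form Z).
  by apply/right_legP/Astar; rewrite -slicel_delta; eexists.
pose F a := \sum_u \tr (a *m (Z u)^t*) *: B u.
have linF : linear F.
  move=> c x y; rewrite /F scaler_sumr -big_split; apply: eq_bigr => u _ /=.
  by rewrite mulmxDl -scalemxAl mxtraceD mxtraceZ scalerDl scalerA.
pose G : {linear M -> M} := HB.pack F (GRing.isLinear.Build _ _ _ _ F linF).
exists G; rewrite [LHS]tens_expandl.
rewrite /G /= /F; under [in RHS]eq_bigr => k _ do rewrite tens_suml.
rewrite exchange_big; apply: eq_bigr => u _ /=.
rewrite -[blockr _ _ _]trmxCK ZE slicel_adj tens_sumr.
by apply: eq_bigr => k _; rewrite tensZl tensZr.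
Qed.

Variables (we wf : {scalar M}).
Let e := slicel V we.
Hypotheses (ue : is_unit_for (right_leg V) e) (uf : is_unit_for (left_leg V) e).
Hypothesis ef : slicer V wf = e.
Hypothesis Lstar : forall a, left_leg V a -> left_leg V (a^t*).
Variable F : {linear M -> M}.
Hypothesis FV : V = \sum_k F ((A k)^t*) *t (B k)^t*.
Local Notation P := (V^t* *m V).
Local Notation Q := (V *m V^t*).

Let Ve : V *m (e *t 1%:M) = V. Proof. by case: (left_unit uf). Qed.
Let eV : (1%:M *t e) *m V = V. Proof. by case: (right_unit ue). Qed.

Lemma antipode_slicer w : F (slicer (V^t*) w) = slicer V w.
Proof.
rewrite [in RHS]FV adj_expand !slicer_sum linear_sum; apply: eq_bigr => k _ /=.
by rewrite !slicer_tens linearZ.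
Qed.

Lemma left_leg_adjE a : left_leg V a <-> exists w, a = slicer (V^t*) w.
Proof.
split=> [/Lstar/left_legP[Z aZ]|[w ->]].
  by exists (trace_form (Z^t*)); rewrite slicer_star -aZ trmxCK.
have /left_legP[Z ->] : left_leg (V^t*) (slicer (V^t*) w) by exists w.
by rewrite -[Z]trmxCK slicer_star; apply: Lstar; eexists.
Qed.

(** The convolution of functionals computes products of slices of V, and
opposite products of slices of V^*. *)
Lemma antipode_mul x y :
  left_leg V x -> left_leg V y -> F (x *m y) = F y *m F x.
Proof.
move=> /left_leg_adjE[w' ->] /left_leg_adjE[w ->].
by rewrite slicer_adj_mul // !antipode_slicer slicer_mul.
Qed.

Lemma antipode_unit : F e = e.
Proof.
case: (uf) => eL eu.
have FeL : left_leg V (F e).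
  by case/left_leg_adjE: eL => w ->; exists w; rewrite antipode_slicer.
have [x xL xe] : exists2 x, left_leg V x & F x = e.
  exists (slicer (V^t*) wf); last by rewrite antipode_slicer ef.
  by apply/left_leg_adjE; exists wf.
by rewrite -[LHS](proj2 (eu _ FeL)) -{2}xe -antipode_mul // (proj2 (eu x xL)).
Qed.

(** Q is the comultiplication of e, so slicing it by wf, a counit for the right
leg, recovers e. *)
Lemma range_counit : slicer Q wf = e.
Proof.
have -> : Q = slice1 we (leg12 V *m leg13 V).
  rewrite mpi_comult_right // -leg23_adj slice1_leg23r slice1_leg23l slice1_leg12.
  by rewrite -/e Ve.
by rewrite slicer_slice1 slice3_leg12l slice3_leg13 ef Ve.
Qed.

Lemma source_counit : P = \sum_k \sum_l wf (B k *m B l) *: (A k *t A l).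
Proof.
have -> : P = slice3 wf (leg13 V *m leg23 V).
  rewrite mpi_comult_left // -leg12_adj slice3_leg12r slice3_leg12l slice3_leg23 ef.
  by rewrite -mulmxA eV.
rewrite leg13_leg23E linear_sum; apply: eq_bigr => k _; rewrite linear_sum.
by apply: eq_bigr => l _; rewrite /= slice3_tens.
Qed.

(** F (x) id *)
Let mapF (T : 'M[C]_(n * n)) := \sum_k F (lcoef T k) *t B k.
Let lcoefE (T : 'M[C]_(n * n)) k :
  lcoef T k = slicer T (trace_form (delta_mx k.2 k.1)).
Proof. by rewrite slicer_delta. Qed.
Let mapFD S T : mapF (S + T) = mapF S + mapF T.
Proof.
rewrite /mapF -big_split; apply: eq_bigr => k _ /=.
by rewrite !lcoefE slicerD linearD tensDl.
Qed.
Let mapF0 : mapF 0 = 0.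
Proof.
by rewrite /mapF big1 // => k _; rewrite lcoefE slicer0 linear0 tens0mx.
Qed.
Let mapF_tens (a b : M) : mapF (a *t b) = F a *t b.
Proof.
rewrite [RHS]tens_expandr; apply: eq_bigr => k _; congr (_ *t _).
by rewrite !lcoefE !slicer_tens linearZ.
Qed.
Let mapF_sum (I : finType) (T : I -> 'M[C]_(n * n)) :
  mapF (\sum_i T i) = \sum_i mapF (T i).
Proof. exact: (big_morph mapF mapFD mapF0). Qed.

Lemma source_antipode c : commutant (source_right_leg V) c ->
  sandwich (mapF P) c = c *m sandwich (mapF P) 1%:M.
Proof.
move=> cB; rewrite [P]tens_expandl mapF_sum !sandwich_sum mulmx_sumr.
apply: eq_bigr => u _; rewrite mapF_tens !sandwich_pure mulmx1 mulmxA.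
by congr (_ *m _); rewrite cB // -slicel_delta; eexists.
Qed.

(** With P as in source_counit and one copy of V replaced by (F (x) id) V^*,
the product becomes F applied to (id (x) wf)(Q), that is F(e). *)
Lemma source_antipode1 : sandwich (mapF P) 1%:M = e.
Proof.
rewrite source_counit mapF_sum sandwich_sum.
transitivity (\sum_k \sum_l wf (B k *m (B l)^t*) *: (F ((A l)^t*) *m F (A k))).
  apply: eq_bigr => k _; rewrite mapF_sum sandwich_sum.
  have BkV : \sum_l A l *t (B k *m B l) =
      \sum_l F ((A l)^t*) *t (B k *m (B l)^t*).
    transitivity ((1%:M *t B k) *m V).
      rewrite [RHS](congr1 (mulmx _) (tens_expandr V)) mulmx_sumr.
      by apply: eq_bigr => l _; rewrite tensmx_mul mul1mx.
    rewrite [LHS](congr1 (mulmx _) FV) mulmx_sumr.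
    by apply: eq_bigr => l _; rewrite tensmx_mul mul1mx.
  transitivity ((\sum_l wf (B k *m B l) *: A l) *m F (A k)).
    rewrite mulmx_suml; apply: eq_bigr => l _.
    by rewrite -tensZl mapF_tens sandwich_pure mulmx1 linearZ -scalemxAr scalemxAl.
  have := congr1 (fun T => slicer T wf *m F (A k)) BkV; rewrite !slicer_sum.
  under eq_bigr => l _ do rewrite slicer_tens.
  move=> ->; rewrite mulmx_suml; apply: eq_bigr => l _.
  by rewrite slicer_tens -scalemxAl.
transitivity (F (slicer Q wf)); last by rewrite range_counit antipode_unit.
have -> : Q = \sum_k \sum_l (A k *m (A l)^t*) *t (B k *m (B l)^t*).
  rewrite adj_expand {1}(tens_expandr V) mul_sum2; apply: eq_bigr => k _.
  by apply: eq_bigr => l _; rewrite tensmx_mul.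
rewrite slicer_sum linear_sum; apply: eq_bigr => k _.
rewrite slicer_sum linear_sum; apply: eq_bigr => l _ /=.
rewrite slicer_tens linearZ /= antipode_mul //; first exact: left_leg_coef.
exact/Lstar/left_leg_coef.
Qed.

(** The preimage of c under the sandwich map is given by the inverse antipode,
as for Hopf algebras, where the element is recovered from
sum_(x) x_2 S^-1(x_1) = counit(x) 1. *)
Lemma calC_commutant c :
  commutant (source_right_leg V) c -> c *m e = c -> calC V c.
Proof.
move=> cB ce; exists (\sum_k B k *m c *m F (A k)).
rewrite -[LHS]ce -source_antipode1 -source_antipode //.
have -> : P = \sum_l \sum_k ((A l)^t* *m A k) *t ((B l)^t* *m B k).
  rewrite adj_expand [X in _ *m X](tens_expandr V) mul_sum2.
  apply: eq_bigr => l _; apply: eq_bigr => k _; by rewrite tensmx_mul.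
transitivity (sandwich (\sum_l F ((A l)^t*) *t (B l)^t*)
  (\sum_k B k *m c *m F (A k))); last by rewrite -FV.
rewrite mapF_sum !sandwich_sum; apply: eq_bigr => l _.
rewrite mapF_sum sandwich_sum sandwich_pure.
rewrite mulmx_sumr mulmx_suml; apply: eq_bigr => k _.
rewrite mapF_tens sandwich_pure antipode_mul ?mulmxA //.
  exact/Lstar/left_leg_coef.
exact: left_leg_coef.
Qed.

End Antipode.

Lemma star_unital_regular (C : numClosedFieldType) (n : nat)
    (V : 'M[C]_(n * n)) : MPI V ->
  is_star_subalgebra (right_leg V) -> is_star_subalgebra (left_leg V) ->
  unital V /\ regular V.
Proof.
move=> hV sA sL.
have [e [ue es]] := star_subalgebra_unit (slicel_linear V) (right_legP V) sA.
have [f [uf fs]] := star_subalgebra_unit (slicer_linear V) (left_legP V) sL.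
case: (ue) => -[we ee] _; case: (uf) => -[wf ff] _; subst e f.
have fe : slicer V wf = slicel V we.
  have <- : slicel V we *m slicer V wf = slicel V we.
    by rewrite -{1}fs -slicel_mulr (right_adj_left_unit hV uf).
  by rewrite -{1}es -slicer_mull (left_adj_right_unit hV ue).
split; first by exists wf, we.
have [_ eV] := right_unit ue; have [Ve _] := left_unit uf.
exists (slicel V we) => // Y; split=> [[X ->]|[YB [X YX]]].
  split.
    move=> a /(source_intertwine hV) aV.
    by rewrite -sandwich_mulr aV sandwich_mull.
  by exists (sandwich V X); rewrite -sandwich_mull eV -sandwich_mulr -fe Ve.
have [F FV] := antipode_exists (proj2 sA).
rewrite fe in uf.
apply: (calC_commutant hV ue uf fe (proj2 sL) FV YB).
by rewrite YX -!mulmxA; case: (ue) => eA /(_ _ eA)[-> _].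
Qed.

(** * The characterization *)

Local Open Scope complex_scope.

Theorem theorem4p5 (R : realType) (n : nat) (V : 'M[R[i]]_(n * n)) (hV : MPI V) :
  (is_star_subalgebra (right_leg V) /\ is_star_subalgebra (left_leg V)) <->
  (unital V /\ regular V).
Proof.
split=> [[sA sL]|[uV rV]]; first exact: star_unital_regular.
exact: unital_regular_star.
Qed.
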